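(* Let $\Phi=(\varphi_n)_{n\in\mathbb N}$ and $\Psi=(\psi_n)_{n\in\mathbb N}$ be two frames for a separable Hilbert space $\mathcal H$ with Bessel bounds $M_\Phi$ and $M_\Psi$, respectively. Then $\Psi$ is a g-dual frame of $\Phi$ if and only if there exists an invertible operator $\mathcal D\in B(\mathcal H)$ such that $T_\Phi U_\Psi=S_\Phi^{1/2}\mathcal D$ and $\mathcal D\mathcal D^*\le M_\Psi\, Id_{\mathcal H}$.
   Context: $\mathcal H$ is a separable Hilbert space, $B(\mathcal H)$ the bounded linear operators on $\mathcal H$, $Id_{\mathcal H}$ the identity operator. A sequence $\Phi=(\varphi_n)_{n\in\mathbb N}$ in $\mathcal H$ is a frame if there are constants $m_\Phi,M_\Phi>0$ with $m_\Phi\|f\|^2\le\sum_{n}|\langle f,\varphi_n\rangle|^2\le M_\Phi\|f\|^2$ for all $f\in\mathcal H$; it is a Bessel sequence with Bessel bound $M_\Phi$ if the second inequality holds. For a Bessel sequence $\Phi$: the analysis operator is $U_\Phi:\mathcal H\to\ell^2$, $U_\Phi f=(\langle f,\varphi_n\rangle)_n$; the synthesis operator is $T_\Phi:\ell^2\to\mathcal H$, $T_\Phi((c_n)_n)=\sum_n c_n\varphi_n$; the frame operator is $S_\Phi=T_\Phi U_\Phi$. For a frame $\Phi$, $S_\Phi$ is bounded, positive and invertible, and $S_\Phi^{1/2}$ is its positive square root. A frame $\Psi=(\psi_n)_n$ is a g-dual (generalized dual) frame of the frame $\Phi$ if there is an invertible $\mathcal A\in B(\mathcal H)$ such that $f=\sum_n\langle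 \mathcal A f,\psi_n\rangle\varphi_n$ for all $f\in\mathcal H$, i.e. $T_\Phi U_\Psi=\mathcal A^{-1}$. *)

(* Defs.v *)
From HB Require Import structures.
From mathcomp Require Import all_boot all_order all_algebra.
From mathcomp Require Import complex.
From mathcomp Require Import all_classical all_reals all_analysis.

Set Implicit Arguments.
Unset Strict Implicit.
Unset Printing Implicit Defensive.

Import Order.TTheory GRing.Theory Num.Theory.
Import numFieldNormedType.Exports.

Local Open Scope classical_set_scope.
Local Open Scope ring_scope.
Local Open Scope complex_scope.

(* Complex Hilbert spaces: the norm of the complete normed module is the one
   induced by the inner product, which is linear in its first argument and
   conjugate-linear in the second. *)
HB.mixin Record isHilbert (R : realType) (H : Type)
    of CompleteNormedModule R[i] H := {
  hilbert_dot : {dot H for (Num.conj : R[i] -> R[i])} ;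
  hilbert_normE : forall x : H, `|x| ^+ 2 = hilbert_dot x x
}.

#[short(type="hilbertType")]
HB.structure Definition Hilbert (R : realType) :=
  {H of isHilbert R H & CompleteNormedModule R[i] H}.

Definition inner (R : realType) (H : hilbertType R) (x y : H) : R[i] :=
  hilbert_dot x y.

(* Norms over R[i] take their (nonnegative real) values in R[i]. *)
Definition normR (R : realType) (V : normedZmodType R[i]) (v : V) : R :=
  complex.Re `|v|.

Definition separable (T : topologicalType) : Prop :=
  exists A : set T, countable A /\ dense A.

Section Operators.
Context {R : realType} {H : hilbertType R}.
Implicit Types A B : H -> H.

Definition bounded_op : set (H -> H) :=
  [set A | linear A /\ exists C : R, forall f, normR (A f) <= C * normR f].

(* Invertible in the algebra B(H) of bounded operators: the inverse is bounded
   too. *)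
Definition invertible_op A : Prop :=
  bounded_op A /\
  exists B, [/\ bounded_op B, A \o B = id & B \o A = id].

Definition positive_op A : Prop := forall f, 0 <= inner (A f) f.

(* The order of R[i] is partial: 0 <= z also says that z is real. *)
Definition le_op A B : Prop := positive_op (fun f => B f - A f).

Definition scalar_op (a : R) : H -> H := fun f => a%:C *: f.

(* A bounded operator has exactly one adjoint, and a positive bounded operator
   exactly one positive square root; the default value \0 of xget plays no
   role in these cases. *)
Definition adjoint_op A : H -> H :=
  xget (\0 : H -> H)
    [set B | bounded_op B /\ forall f g, inner (A f) g = inner f (B g)].

Definition sqrt_op A : H -> H :=
  xget (\0 : H -> H)
    [set B | [/\ bounded_op B, positive_op B & B \o B = A]].

End Operators.

Section Frames.
Context {R : realType} {H : hilbertType R}.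
Implicit Types Phi Psi : nat -> H.

(* Extended-real sum of nonnegative terms, so that an upper bound by a real
   number includes the convergence of the series. *)
Definition frame_sum Phi (f : H) : \bar R :=
  \sum_(0 <= n <oo) ((normR (inner f (Phi n)) ^+ 2)%:E).

Definition bessel_bound Phi (M : R) : Prop :=
  0 < M /\ forall f, (frame_sum Phi f <= (M * normR f ^+ 2)%:E)%E.

Definition is_frame Phi : Prop :=
  exists m M : R, [/\ 0 < m, bessel_bound Phi M &
    forall f, ((m * normR f ^+ 2)%:E <= frame_sum Phi f)%E].

Definition analysis_op Phi (f : H) : nat -> R[i] := fun n => inner f (Phi n).

(* Total on all sequences; meaningful on l^2, where the series converges when
   Phi is Bessel. Analysis operators of Bessel sequences take values in l^2. *)
Definition synthesis_op Phi (c : nat -> R[i]) : H :=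
  limn (series (fun n => c n *: Phi n)).

Definition frame_op Phi : H -> H := synthesis_op Phi \o analysis_op Phi.

Definition g_dual Phi Psi : Prop :=
  exists A : H -> H, invertible_op A /\
    forall f, series (fun n => inner (A f) (Psi n) *: Phi n) @ \oo --> f.

End Frames.

(* Main.v *)
(* All estimates are made with the real inner product Re <x, y>, which determines
   the complex one. If K = T_Phi U_Psi is invertible, put D = S^(-1/2) K; then
   D* = T_Psi U_Phi S^(-1/2), so that
   |D* g|^2 <= M_Psi |U_Phi S^(-1/2) g|^2 = M_Psi <S S^(-1/2) g, S^(-1/2) g>
             = M_Psi |g|^2.
   Conversely S^(1/2) is invertible, hence so is S^(1/2) D = T_Phi U_Psi.
   The frame bounds write S as a (1 - X) with a > 0, X self-adjoint and
   |X| < 1, which yields both the inverse and the square root of S. *)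
From HB Require Import structures.
Require Import Defs.
From mathcomp Require Import all_boot all_order all_algebra.
From mathcomp Require Import complex.
From mathcomp Require Import all_classical all_reals all_analysis.
From mathcomp Require Import ring lra.

Set Implicit Arguments.
Unset Strict Implicit.
Unset Printing Implicit Defensive.

Import Order.TTheory GRing.Theory Num.Theory.
Import numFieldNormedType.Exports.

Local Open Scope classical_set_scope.
Local Open Scope ring_scope.
Local Open Scope complex_scope.

(** * Real-valued norms and convergence *)

Section RealNorm.
Context {R : realType} {V : normedZmodType R[i]}.
Implicit Types x y : V.

Lemma normRE x : `|x| = (normR x)%:C.
Proof. by rewrite /normR RRe_real ?normr_real. Qed.

Lemma normR_ge0 x : 0 <= normR x.
Proof. by rewrite -lecR -normRE normr_ge0. Qed.

Lemma normR0 : normR (0 : V) = 0.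
Proof. by rewrite /normR normr0. Qed.

Lemma normR_eq0 x : (normR x == 0) = (x == 0).
Proof. by rewrite -(inj_eq (@complexI R)) -normRE normr_eq0. Qed.

Lemma normRN x : normR (- x) = normR x.
Proof. by rewrite /normR normrN. Qed.

Lemma normRB x y : normR (x - y) = normR (y - x).
Proof. by rewrite /normR distrC. Qed.

Lemma ler_normRD x y : normR (x + y) <= normR x + normR y.
Proof. by rewrite -lecR rmorphD/= -!normRE ler_normD. Qed.

End RealNorm.

Section RealNormMod.
Context {R : realType} {V : normedModType R[i]}.
Implicit Types x y : V.

Lemma normRZ (a : R[i]) x : normR (a *: x) = normR a * normR x.
Proof.
apply: (@complexI R); rewrite rmorphM/= -!normRE normrZ.
by congr (_ * _); rewrite /normR RRe_real ?normr_real.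
Qed.

Lemma normRZr (a : R) x : 0 <= a -> normR (a%:C *: x) = a * normR x.
Proof. by move=> a0; rewrite normRZ /normR ger0_norm// lecR. Qed.

Lemma cvg_normRP (u : nat -> V) l :
  u @ \oo --> l <-> (fun n => normR (l - u n)) @ \oo --> (0 : R).
Proof.
split=> [/cvgrPdist_lt ul|/cvgrPdist_lt ul]; apply/cvgrPdist_lt => e e0.
  have e0' : 0 < e%:C by rewrite ltcR.
  near=> n; rewrite sub0r normrN ger0_norm ?normR_ge0// -ltcR -normRE.
  by near: n; exact: ul.
(* A positive element of [R[i]] has zero imaginary part, so the complex radius [e] is a positive
   real. *)
have [er ei] : complex.Im e = 0 /\ 0 < complex.Re e.
  by move: e0; rewrite ltcE => /andP[/eqP -> ->].
have -> : e = (complex.Re e)%:C by apply/eqP; rewrite eq_complex/= er !eqxx.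
near=> n; rewrite normRE ltcR.
have : `|0 - normR (l - u n)| < complex.Re e by near: n; exact: ul.
by rewrite sub0r normrN ger0_norm ?normR_ge0.
Unshelve. all: by end_near. Qed.

Lemma cvg_normR_le (u : nat -> V) l (e : nat -> R) :
  (forall n, normR (l - u n) <= e n) -> e @ \oo --> (0 : R) -> u @ \oo --> l.
Proof.
move=> ule e0; apply/cvg_normRP; apply: squeeze_cvgr (cvg_cst 0) e0.
by near=> n; rewrite normR_ge0 ule.
Unshelve. all: by end_near. Qed.

Lemma limit_normR_le (u : nat -> V) l (c : R) :
  u @ \oo --> l -> (forall n, normR (u n) <= c) -> normR l <= c.
Proof.
move=> /cvg_normRP ul uc.
have lim1 : (fun n => normR (l - u n) + c) @ \oo --> 0 + c.
  by apply: cvgD => //; exact: cvg_cst.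
(* Pass to the limit in |l| <= |l - u n| + c. *)
rewrite -[c]add0r; apply: ler_cvg_to (cvg_cst (normR l)) lim1 _.
near=> n; rewrite -{1}[l](subrK (u n)).
by apply: le_trans (ler_normRD _ _) _; rewrite lerD2l.
Unshelve. all: by end_near. Qed.

End RealNormMod.

(* The exponent k is 1 for geometric series and 2 for sums c_n Phi_n with c
   square-summable. *)
Lemma cvg_dominated {R : realType} {V : completeNormedModType R[i]} (k : nat)
    (u : nat -> V) (s : nat -> R) : (0 < k)%N -> cvgn s ->
  (forall m n, (m <= n)%N -> normR (u n - u m) ^+ k <= s n - s m) -> cvgn u.
Proof.
move=> k0 sc us; apply/cauchy_cvgP/cauchyP => e e0.
have ee : e = (normR e)%:C by rewrite -normRE gtr0_norm.
have r0 : 0 < normR e by rewrite -ltcR -ee.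
(* Halved because [s n] and [s N] are each this close to the limit of [s], and their difference must
   stay below |e|^k. *)
have rk0 : 0 < normR e ^+ k / 2 by rewrite divr_gt0// exprn_gt0.
have /cvgrPdist_lt/(_ _ rk0)[N _ sN] := sc.
exists (u N); exists N => // n /= Nn.
rewrite -ball_normE /ball_/= ee normRE ltcR normRB.
rewrite -(ltr_pXn2r k0) ?nnegrE ?normR_ge0//.
apply: le_lt_trans (us _ _ Nn) _.
have := sN _ Nn; have := sN _ (leqnn N); rewrite /= !ltr_norml.
by move=> /andP[? ?] /andP[? ?]; lra.
Qed.

(** * The real inner product and the Cauchy-Schwarz inequality *)

Section RealDot.
Context {R : realType} {H : hilbertType R}.
Implicit Types x y z : H.

Lemma innerC x y : inner x y = (inner y x)^*.
Proof. by rewrite /inner (hermC hilbert_dot) expr0 mul1r. Qed.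

Lemma innerDl x y z : inner (x + y) z = inner x z + inner y z.
Proof. exact: linearDl. Qed.

Lemma innerZl a x z : inner (a *: x) z = a * inner x z.
Proof. exact: linearZl_LR. Qed.

Lemma inner_normR x : inner x x = (normR x ^+ 2)%:C.
Proof. by rewrite rmorphXn/= -normRE hilbert_normE. Qed.

Definition rdot x y : R := complex.Re (inner x y).

Lemma rdotC x y : rdot x y = rdot y x.
Proof. by rewrite /rdot innerC; case: (inner y x). Qed.

Lemma rdotDl x y z : rdot (x + y) z = rdot x z + rdot y z.
Proof. by rewrite /rdot innerDl; case: (inner x z) (inner y z) => ? ? []. Qed.

Lemma rdotZl (a : R) x z : rdot (a%:C *: x) z = a * rdot x z.
Proof.
by rewrite /rdot innerZl; case: (inner x z) => ? ? /=; rewrite mul0r subr0.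
Qed.

Lemma rdotNl x z : rdot (- x) z = - rdot x z.
Proof. by rewrite -scaleN1r -(rmorphN1 (@real_complex R)) rdotZl mulN1r. Qed.

Lemma rdotBl x y z : rdot (x - y) z = rdot x z - rdot y z.
Proof. by rewrite rdotDl rdotNl. Qed.

Lemma rdot0l z : rdot 0 z = 0.
Proof. by rewrite -(subrr (0 : H)) rdotBl subrr. Qed.

Lemma rdotDr x y z : rdot z (x + y) = rdot z x + rdot z y.
Proof. by rewrite rdotC rdotDl !(rdotC z). Qed.

Lemma rdotBr x y z : rdot z (x - y) = rdot z x - rdot z y.
Proof. by rewrite rdotC rdotBl !(rdotC z). Qed.

Lemma rdotZr (a : R) x z : rdot z (a%:C *: x) = a * rdot z x.
Proof. by rewrite rdotC rdotZl rdotC. Qed.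

Lemma rdot_normR x : rdot x x = normR x ^+ 2.
Proof. by rewrite /rdot inner_normR. Qed.

(** Conjugate-linearity gives <x, i y> = -i <x, y>, whose real part is Im <x, y>. *)
Lemma innerE x y : inner x y = rdot x y +i* rdot x ('i *: y).
Proof.
apply/eqP; rewrite eq_complex /rdot /= eqxx/= [X in _ == complex.Re X]innerC.
rewrite innerZl innerC; case: (inner y x) => a b /=.
by rewrite mul0r mul1r sub0r.
Qed.

(** With a = |x| and b = |y|, expanding |b x - a y|^2 >= 0 gives 2 a b (a b - Re <x, y>) >= 0; the
    case a b = 0 is separate because a b is then cancelled. *)
Lemma rdot_le x y : rdot x y <= normR x * normR y.
Proof.
have [/eqP|] := eqVneq (normR x * normR y) 0.
  rewrite mulf_eq0 !normR_eq0 => /orP[] /eqP ->.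
    by rewrite rdot0l normR0 mul0r.
  by rewrite rdotC rdot0l normR0 mulr0.
set a := normR x; set b := normR y => ab0.
have ab_gt0 : 0 < a * b by rewrite lt_neqAle eq_sym ab0 mulr_ge0 ?normR_ge0.
rewrite -(ler_pM2l ab_gt0).
have := sqr_ge0 (normR (b%:C *: x - a%:C *: y)).
rewrite -rdot_normR rdotBl !rdotBr !rdotZl !rdotZr !rdot_normR -/a -/b.
rewrite (rdotC y x); nra.
Qed.

Lemma norm_rdot_le x y : `|rdot x y| <= normR x * normR y.
Proof. by rewrite ler_norml rdot_le lerNl -rdotNl -(normRN x) rdot_le. Qed.

Lemma cvg_rdotl (u : nat -> H) l z :
  u @ \oo --> l -> (fun n => rdot (u n) z) @ \oo --> rdot l z.
Proof.
move=> /cvg_normRP ul; apply/subr_cvg0/norm_cvg0P.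
have ul0 : (fun n => normR (l - u n) * normR z) @ \oo --> (0 : R).
  by rewrite -(mul0r (normR z)); apply: cvgM ul (cvg_cst _).
apply: squeeze_cvgr (cvg_cst 0) ul0; near=> n.
by rewrite normr_ge0 -rdotBl normRB norm_rdot_le.
Unshelve. all: by end_near. Qed.

End RealDot.

(** * Bounded and invertible operators *)

Section Operators.
Context {R : realType} {H : hilbertType R}.
Implicit Types (A B X Y : H -> H) (f g : H) (q C : R).

(** Bundles a bare function as a linear map, so that the generic lemmas on linear maps apply to
    it. *)
Lemma linear_ext A : linear A -> exists A' : {linear H -> H}, A = A'.
Proof.
move=> lA; pose A' : {linear H -> H} :=
  HB.pack A (GRing.isLinear.Build R[i] H H _ A lA).
by exists A'.
Qed.

Lemma linear_opB A f g : linear A -> A (f - g) = A f - A g.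
Proof. by move=> /linear_ext[A' ->]; rewrite linearB. Qed.

Lemma linear_opD A f g : linear A -> A (f + g) = A f + A g.
Proof. by move=> /linear_ext[A' ->]; rewrite linearD. Qed.

Lemma linear_opZ A a f : linear A -> A (a *: f) = a *: A f.
Proof. by move=> /linear_ext[A' ->]; rewrite linearZ. Qed.

Lemma linear_op0 A : linear A -> A 0 = 0.
Proof. by move=> /linear_ext[A' ->]; rewrite linear0. Qed.

Lemma bounded_op_gt0 A : bounded_op A ->
  exists2 C, 0 < C & forall f, normR (A f) <= C * normR f.
Proof.
move=> [_ [C AC]]; exists (`|C| + 1); first by rewrite ltr_wpDl.
move=> f; apply: le_trans (AC f) _; apply: ler_wpM2r; first exact: normR_ge0.
by rewrite (le_trans (ler_norm C))// lerDl.
Qed.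

Lemma bounded_op_cvg A (u : nat -> H) l : bounded_op A ->
  u @ \oo --> l -> (fun n => A (u n)) @ \oo --> A l.
Proof.
move=> bA /cvg_normRP ul; have [C C0 AC] := bounded_op_gt0 bA.
apply: (@cvg_normR_le _ _ _ _ (fun n => C * normR (l - u n))) => [n|].
  by rewrite -linear_opB//; case: bA.
by rewrite -(mulr0 C); apply: cvgM (cvg_cst _) ul.
Qed.

Lemma bounded_op_comp A B : bounded_op A -> bounded_op B -> bounded_op (A \o B).
Proof.
move=> bA bB; have [C C0 AC] := bounded_op_gt0 bA.
have [lA _] := bA; have [lB [D BD]] := bB; split.
  by move=> a f g /=; rewrite lB lA.
exists (C * D) => f /=; apply: le_trans (AC _) _.
by rewrite -mulrA ler_wpM2l// ltW.
Qed.

Lemma bounded_opZ a A : bounded_op A -> bounded_op (fun f => a *: A f).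
Proof.
move=> [lA [C AC]]; split=> [b f g|].
  by rewrite lA scalerDr !scalerA mulrC.
exists (normR a * C) => f; rewrite normRZ -mulrA ler_wpM2l//.
exact: normR_ge0.
Qed.

Lemma invertible_op_comp A B :
  invertible_op A -> invertible_op B -> invertible_op (A \o B).
Proof.
move=> [bA [A' [bA' AA' A'A]]] [bB [B' [bB' BB' B'B]]].
split; first exact: bounded_op_comp.
exists (B' \o A'); split; first exact: bounded_op_comp.
  by rewrite -compA (compA B) BB'; exact: AA'.
by rewrite -compA (compA A') A'A; exact: B'B.
Qed.

Lemma invertible_opZ a A :
  a != 0 -> invertible_op A -> invertible_op (fun f => a *: A f).
Proof.
move=> a0 [bA [B [bB AB BA]]]; split; first exact: bounded_opZ.
exists (fun f => B (a^-1 *: f)); split.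
- apply: (bounded_op_comp bB); split=> [b f g|].
    by rewrite scalerDr !scalerA mulrC.
  by exists (normR a^-1) => f; rewrite normRZ.
- apply/funext => f /=; have /= -> := congr1 (@^~ (a^-1 *: f)) AB.
  by rewrite scalerA divff// scale1r.
- apply/funext => f /=; rewrite scalerA mulVf// scale1r.
  exact: (congr1 (@^~ f) BA).
Qed.

(** The lower bound serves twice: it makes A injective, whence the inverse is linear, and it bounds
    the inverse by C^-1. *)
Lemma invertible_bounded_below A C : bounded_op A -> 0 < C ->
  (forall f, C * normR f <= normR (A f)) -> (forall g, exists f, A f = g) ->
  invertible_op A.
Proof.
move=> bA C0 CA surjA; split=> //; have [lA _] := bA.
have [B AB] := choice surjA.
have injA f g : A f = A g -> f = g.
  move=> fg; have : C * normR (f - g) <= 0.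
    by rewrite (le_trans (CA _))// linear_opB// fg subrr normR0.
  rewrite pmulr_rle0// => fg0; apply/eqP.
  by rewrite -subr_eq0 -normR_eq0 eq_le normR_ge0 fg0.
exists B; split; last 2 first.
- exact/funext.
- by apply/funext => f; apply: injA; rewrite /= AB.
split; first by move=> a f g; apply: injA; rewrite lA !AB.
exists C^-1 => f; rewrite -(ler_pM2l C0) mulrA divff ?gt_eqF// mul1r.
by rewrite -{2}(AB f).
Qed.

(** * Contractions, self-adjointness and pointwise limits *)

Definition contraction q A := linear A /\ forall f, normR (A f) <= q * normR f.

(** Symmetry of the real part only; for linear A it amounts to symmetry for [inner], since multiples
    of g by complex scalars recover the imaginary part. *)
Definition selfadjoint A := forall f g, rdot (A f) g = rdot f (A g).

Lemma contraction_bounded q A : contraction q A -> bounded_op A.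
Proof. by move=> [lA qA]; split=> //; exists q. Qed.

(** Telescoping bounds |u n - u m| by a block of the geometric series, whose partial sums are the
    dominating sequence. *)
Lemma geometric_cvg (u : nat -> H) C q : 0 <= q < 1 ->
  (forall n, normR (u n.+1 - u n) <= q ^+ n * C) -> cvgn u.
Proof.
move=> /andP[q0 q1] uq.
apply: (@cvg_dominated _ _ 1 _ (series (geometric C q))) => //.
  by apply: is_cvg_geometric_series; rewrite ger0_norm.
move=> m n mn; rewrite expr1; elim: n mn => [|n IH].
  by rewrite leqn0 => /eqP ->; rewrite !subrr normR0.
rewrite leq_eqVlt => /predU1P[->|]; first by rewrite !subrr normR0.
rewrite ltnS => /IH {}IH.
rewrite -(subrK (u n) (u n.+1)) -addrA (le_trans (ler_normRD _ _))//.
rewrite (le_trans (lerD (uq n) IH))// seriesEnat/= big_nat_recr//=.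
by rewrite [q ^+ n * C]mulrC addrA [_ + \sum_(0 <= k < n) _]addrC.
Qed.

(* The Neumann series: the partial sums are the iterates of u |-> g + X u. *)
Lemma contraction_invertible q X : 0 <= q < 1 -> contraction q X ->
  invertible_op (fun f => f - X f).
Proof.
move=> q01 cX; have /andP[q0 q1] := q01; have [lX qX] := cX.
(* The lower bound 1 - q comes from |f| <= |f - X f| + |X f|. *)
apply: (@invertible_bounded_below _ (1 - q)); last 3 first.
- by rewrite subr_gt0.
- move=> f; have := ler_normRD (f - X f) (X f); rewrite subrK.
  by have := qX f; lra.
- move=> g; pose u n := iter n (fun f => g + X f) 0.
  have uS n : u n.+1 = g + X (u n) by [].
  have /(geometric_cvg q01) : forall n, normR (u n.+1 - u n) <= q ^+ n * normR g.
    elim=> [|n IH]; first by rewrite /u/= linear_op0// addr0 subr0 expr0 mul1r.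
    rewrite (uS n.+1) [X in _ - X]uS opprD addrACA subrr add0r -linear_opB//.
    rewrite (le_trans (qX _))// exprS -mulrA.
    by rewrite ler_wpM2l.
  move=> ul; exists (limn u); apply/eqP; rewrite subr_eq; apply/eqP.
  have ul1 : (fun n => u n.+1) @ \oo --> limn u by rewrite cvg_shiftS.
  apply: (cvg_unique (@norm_hausdorff _ _) ul1).
  apply: cvgD; first exact: cvg_cst.
  exact: bounded_op_cvg (contraction_bounded cX) ul.
split=> [a f g|]; first by rewrite lX scalerBr opprD addrACA.
exists (1 + q) => f; rewrite (le_trans (ler_normRD _ _))// normRN mulrDl mul1r.
by rewrite lerD2l.
Qed.

Lemma cvg_contraction q (A_ : nat -> H -> H) A :
  (forall n, contraction q (A_ n)) ->
  (forall f, (fun n => A_ n f) @ \oo --> A f) -> contraction q A.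
Proof.
move=> qA AA; split=> [a f g|f]; last first.
  by apply: limit_normR_le (AA f) _ => n; have [_] := qA n.
apply: (cvg_unique (@norm_hausdorff _ _) (AA _)) => /=.
have : (fun n => a *: A_ n f + A_ n g) @ \oo --> a *: A f + A g.
  by apply: cvgD (AA g); exact: cvgZl_tmp (AA f).
by apply: cvg_trans; apply: near_eq_cvg; near=> n; have [-> _] := qA n.
Unshelve. all: by end_near. Qed.

Lemma cvg_selfadjoint (A_ : nat -> H -> H) A :
  (forall n, selfadjoint (A_ n)) ->
  (forall f, (fun n => A_ n f) @ \oo --> A f) -> selfadjoint A.
Proof.
move=> sA AA f g; have fg := cvg_rdotl (z := g) (AA f).
apply: (cvg_unique (@norm_hausdorff _ R^o) fg) => /=; rewrite rdotC.
apply: cvg_trans (cvg_rdotl (z := f) (AA g)); apply: near_eq_cvg.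
by near=> n; rewrite sA rdotC.
Unshelve. all: by end_near. Qed.

(** * The square root of 1 - X for a self-adjoint contraction X *)

Definition sqrt_step X Y f : H := 2^-1%:C *: (X f + Y (Y f)).

(** The norm is at most (q + q^2) / 2, which is at most q since q < 1. *)
Lemma sqrt_step_contraction q X Y : 0 <= q < 1 ->
  contraction q X -> contraction q Y -> contraction q (sqrt_step X Y).
Proof.
move=> /andP[q0 q1] [lX qX] [lY qY]; split=> [a f g|f].
  by rewrite /sqrt_step lX !lY !scalerDr !scalerA mulrC addrACA.
rewrite /sqrt_step normRZr ?invr_ge0// -(ler_pM2l (@ltr0Sn R 1)) mulVKf//.
have := ler_normRD (X f) (Y (Y f)); have := qX f; have := qY (Y f).
have : q * normR (Y f) <= normR (Y f) by rewrite ler_piMl ?normR_ge0// ltW.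
by have := qY f; lra.
Qed.

Lemma sqrt_step_selfadjoint X Y :
  selfadjoint X -> selfadjoint Y -> selfadjoint (sqrt_step X Y).
Proof.
by move=> sX sY f g; rewrite /sqrt_step rdotZl rdotZr rdotDl rdotDr sX !sY.
Qed.

(* The binomial series of the square root is avoided: Y |-> (X + Y^2) / 2 is a
   q-contraction of the ball of radius q, and (1 - Y)^2 = 1 - X at its fixed
   point. *)
Lemma contraction_sqrt q X : 0 <= q < 1 -> contraction q X -> selfadjoint X ->
  exists Y, [/\ contraction q Y, selfadjoint Y &
    forall f, (f - Y f) - Y (f - Y f) = f - X f].
Proof.
move=> q01 cX sX; have /andP[q0 q1] := q01.
pose Y_ n := iter n (sqrt_step X) (fun=> 0).
have YS n f : Y_ n.+1 f = sqrt_step X (Y_ n) f by [].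
have cY n : contraction q (Y_ n).
  elim: n => [|n IH]; last exact: sqrt_step_contraction.
  by split=> [a f g|f]; rewrite ?scaler0 ?addr0// normR0 mulr_ge0 ?normR_ge0.
have sY n : selfadjoint (Y_ n).
  elim: n => [|n IH]; last exact: sqrt_step_selfadjoint.
  by move=> f g; rewrite /= rdot0l rdotC rdot0l.
have dY f n : normR (Y_ n.+1 f - Y_ n f) <= q ^+ n * normR f.
  elim: n f => [|n IH] f.
    rewrite YS /sqrt_step/= addr0 subr0 normRZr ?invr_ge0// expr0 mul1r.
    have [_ /(_ f)] := cX; have : q * normR f <= normR f.
      by rewrite ler_piMl ?normR_ge0// ltW.
    by have := normR_ge0 f; lra.
  rewrite (YS n.+1) [X in _ - X]YS /sqrt_step -scalerBr.
  rewrite opprD addrACA subrr add0r normRZr ?invr_ge0//.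
  rewrite -(ler_pM2l (@ltr0Sn R 1)) mulVKf//.
  have [lS qS] := cY n.+1; have [ln qn] := cY n.
  (* With P = [Y_ n.+1] and Q = [Y_ n], split P P - Q Q = P (P - Q) + (P - Q) Q. Each term is at
     most q^(n+1) |f|, the second by the induction hypothesis at Q f; the factor 1/2 absorbs the
     sum. *)
  rewrite -(subrK (Y_ n.+1 (Y_ n f)) (Y_ n.+1 (Y_ n.+1 f))) -addrA.
  rewrite -linear_opB//; apply: le_trans (ler_normRD _ _) _.
  have := qS (Y_ n.+1 f - Y_ n f); have := IH (Y_ n f).
  have := ler_wpM2l q0 (IH f).
  have := ler_wpM2l (exprn_ge0 n q0) (qn f).
  by rewrite exprS; lra.
pose Y f := limn (fun n => Y_ n f).
have YY f : (fun n => Y_ n f) @ \oo --> Y f by exact: geometric_cvg q01 (dY f).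
have cYl : contraction q Y := cvg_contraction cY YY.
exists Y; split=> // [|f]; first exact: cvg_selfadjoint sY YY.
have fixY : Y f = sqrt_step X Y f.
  have Yf1 : (fun n => Y_ n.+1 f) @ \oo --> Y f.
    by rewrite (cvg_shiftS (Y_^~ f)); exact: YY.
  apply: (cvg_unique (@norm_hausdorff _ _) Yf1) => /=.
  apply: cvgZl_tmp; apply: cvgD; first exact: cvg_cst.
  (* The uniform bound q on the iterates lets pointwise convergence pass through the composition
     [Y_ n (Y_ n f)]. *)
  apply: (@cvg_normR_le _ _ _ _
    (fun n => normR (Y (Y f) - Y_ n (Y f)) + q * normR (Y f - Y_ n f))).
    move=> n; have [lY qY] := cY n.
    rewrite -(subrK (Y_ n (Y f)) (Y (Y f))) -addrA -linear_opB//.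
    by rewrite subrK (le_trans (ler_normRD _ _))// lerD2l.
  rewrite -(addr0 0) -{2}(mulr0 q); apply: cvgD.
    by apply/cvg_normRP; exact: YY.
  by apply: cvgM; [exact: cvg_cst|apply/cvg_normRP; exact: YY].
have [lY _] := cYl; rewrite linear_opB//.
have -> : X f = 2%:R%:C *: Y f - Y (Y f).
  rewrite {1}fixY /sqrt_step scalerA -rmorphM/= divff// scale1r addrK//.
by rewrite rmorph_nat scaler_nat mulr2n !opprD !opprK !addrA.
Qed.

(** * Complex scalars, positivity, and roots of coercive operators *)

Lemma rdotZil f g : rdot ('i *: f) g = - rdot f ('i *: g).
Proof.
rewrite /rdot [in RHS]innerC !innerZl innerC; case: (inner g f) => a b /=.
by rewrite mul0r !mul1r !sub0r.
Qed.

Lemma rdotZi f g : rdot ('i *: f) ('i *: g) = rdot f g.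
Proof.
by rewrite rdotZil scalerA -expr2 sqr_i rdotC scaleN1r rdotNl opprK rdotC.
Qed.

(** The scalars 1 and i give the real and imaginary parts through [innerE]. *)
Lemma inner_ext f g f' g' :
  (forall a : R[i], rdot f (a *: g) = rdot f' (a *: g')) ->
  inner f g = inner f' g'.
Proof. by move=> E; rewrite !innerE E -(scale1r g) E scale1r. Qed.

(** What remains is that <A f, f> is real: symmetry of A and skewness of multiplication by i make Re
    <A f, i f> equal to its own negative. *)
Lemma selfadjoint_positive A : linear A -> selfadjoint A ->
  (forall f, 0 <= rdot (A f) f) -> positive_op A.
Proof.
move=> lA sA A0 f; rewrite innerE lecE/= A0 andbT; apply/eqP.
have := sA f ('i *: f); rewrite linear_opZ// -[X in _ = X]opprK -rdotZil rdotC.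
lra.
Qed.

(* Polarisation: over the complex numbers positivity forces symmetry. *)
Lemma positive_selfadjoint A : linear A -> positive_op A -> selfadjoint A.
Proof.
move=> lA A0 f g.
have im0 h : rdot (A h) ('i *: h) = 0.
  by have := A0 h; rewrite innerE lecE/= => /andP[/eqP].
have := im0 (f + 'i *: g); rewrite linear_opD// linear_opZ// scalerDr.
rewrite rdotDl !rdotDr !rdotZi !im0 scalerA -expr2 sqr_i scaleN1r.
rewrite (rdotC (A f) (- g)) rdotNl (rdotC g) (rdotC f); lra.
Qed.

(** Positivity of X at f - q^-1 X f, with <X X f, X f> <= q |X f|^2, yields |X f|^2 <= q <X f, f> <=
    q^2 |f|^2. *)
Lemma selfadjoint_contraction q X : 0 < q -> linear X -> selfadjoint X ->
  (forall f, 0 <= rdot (X f) f <= q * normR f ^+ 2) -> contraction q X.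
Proof.
move=> q0 lX sX Xq; split=> // f.
rewrite -(ler_pXn2r (ltn0Sn 1)) ?nnegrE ?mulr_ge0 ?normR_ge0 ?(ltW q0)//.
have /andP[+ _] := Xq (f - q^-1%:C *: X f).
have /andP[_] := Xq (X f); have /andP[_] := Xq f.
rewrite linear_opB// linear_opZ// rdotBl !rdotBr !rdotZl !rdotZr.
rewrite (sX (X f) f) rdot_normR; set a := rdot _ _; set c := rdot (X (X f)) _.
set b := normR (X f) ^+ 2; set d := normR f ^+ 2 => ad cb.
rewrite exprMn -/d => le0.
have := mulr_ge0 (sqr_ge0 q) le0.
have -> : q ^+ 2 * (a - q^-1 * b - (q^-1 * b - q^-1 * (q^-1 * c))) =
          q ^+ 2 * a - q * b * 2 + c by field; rewrite gt_eqF.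
by move=> h; rewrite -(ler_pM2l q0); nra.
Qed.

Lemma coercive_sqrt (m M : R) A : 0 < m -> 0 < M -> linear A -> selfadjoint A ->
  (forall f, m * normR f ^+ 2 <= rdot (A f) f <= M * normR f ^+ 2) ->
  invertible_op A /\ exists B, [/\ bounded_op B, positive_op B & B \o B = A].
Proof.
(* Dividing by M + m places X = 1 - A / a between 0 and 1 - m / a = M / a = q. This q is strictly
   between 0 and 1 even when m = M. *)
move=> m0 M0 lA sA Am; pose a := M + m; have a0 : 0 < a by rewrite addr_gt0.
pose X f := f - a^-1%:C *: A f; pose q := M / a.
have q0 : 0 < q by rewrite divr_gt0.
have q01 : 0 <= q < 1 by rewrite ltW//= ltr_pdivrMr// mul1r ltrDl.
have lX : linear X.
  move=> b f g; rewrite /X lA !scalerDr opprD addrACA scalerN !scalerA.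
  by rewrite [b * _]mulrC.
have sX : selfadjoint X.
  by move=> f g; rewrite /X rdotBl rdotBr rdotZl rdotZr sA.
have cX : contraction q X.
  apply: selfadjoint_contraction => // f; rewrite rdotBl rdotZl rdot_normR.
  have /andP[mA AM] := Am f.
  rewrite subr_ge0 ler_pdivrMl// lerBlDr -mulrA.
  rewrite (le_trans AM) ?ler_wpM2r ?sqr_ge0 ?lerDl ?(ltW m0)//=.
  have -> : M * (a^-1 * normR f ^+ 2) =
            normR f ^+ 2 - a^-1 * (m * normR f ^+ 2).
    by rewrite /a; field; rewrite gt_eqF.
  have : 0 <= a^-1 by rewrite invr_ge0 ltW.
  by move=> /ler_wpM2l/(_ _ _ mA); lra.
have AX : A = fun f => a%:C *: (f - X f).
  apply/funext => f; rewrite /X subKr scalerA -rmorphM/= divff ?gt_eqF//.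
  by rewrite scale1r.
split.
  rewrite AX; apply: invertible_opZ (contraction_invertible q01 cX).
  by rewrite -(rmorph0 (real_complex R)) (inj_eq (@complexI R)) gt_eqF.
have [Y [cY sY XY]] := contraction_sqrt q01 cX sX; have [lY qY] := cY.
pose s := Num.sqrt a; have s0 : 0 <= s by exact: sqrtr_ge0.
have [[lI [C IC]] _] := contraction_invertible q01 cY.
(* Since (1 - Y)^2 = 1 - X = A / a, the root is sqrt a (1 - Y); it is positive because |Y f| <=
   |f|. *)
exists (fun f => s%:C *: (f - Y f)); split.
- by apply: bounded_opZ; split => //; exists C.
- apply: selfadjoint_positive => [b f g|f g|f].
  + by rewrite lI !scalerDr !scalerA mulrC.
  + by rewrite rdotZl rdotZr rdotBl rdotBr sY.
  + rewrite rdotZl mulr_ge0// rdotBl subr_ge0 (le_trans (rdot_le _ _))//.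
    rewrite rdot_normR expr2 ler_wpM2r ?normR_ge0// (le_trans (qY f))//.
    by rewrite ler_piMl ?normR_ge0// ltW//; case/andP: q01.
- apply/funext => f /=; rewrite (linear_opZ _ _ lY) -scalerBr XY scalerA.
  by rewrite -rmorphM/= -expr2 sqr_sqrtr ?(ltW a0)// AX.
Qed.

End Operators.

(** * Bessel sequences and convergence of synthesis *)

Section Frames.
Context {R : realType} {H : hilbertType R}.
Implicit Types (Phi Psi : nat -> H) (f g x y : H) (M N : R) (c : nat -> R[i]).

Lemma inner_adjoint (A B : H -> H) : linear B ->
  (forall f g, rdot (A f) g = rdot f (B g)) ->
  forall f g, inner (A f) g = inner f (B g).
Proof.
by move=> lB AB f g; apply: inner_ext => a; rewrite AB linear_opZ.
Qed.

Lemma Re_le_normR (z : R[i]) : complex.Re z <= normR z.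
Proof. by rewrite (le_trans (ler_norm _))// -lecR -normRE normc_ge_Re. Qed.

Lemma rdotZ_le (a : R[i]) x g : rdot (a *: x) g <= normR a * normR (inner g x).
Proof.
rewrite /rdot innerZl (le_trans (Re_le_normR _))//.
have -> : normR (inner g x) = normR (inner x g).
  by rewrite innerC /normR normcJ.
by rewrite (@normRZ _ R[i]^o a).
Qed.

(** The rank-one operators f |-> <f, y> x and g |-> <g, x> y are adjoint; this is the termwise form
    of the adjoint of T_Phi U_Psi. *)
Lemma rdot_innerZ f g x y : rdot (inner f y *: x) g = rdot f (inner g x *: y).
Proof.
rewrite [RHS]rdotC /rdot !innerZl (innerC x g) (innerC y f).
by case: (inner f y) (inner g x) => a b [a' b'] /=; ring.
Qed.

Lemma rdot_suml m n (F : nat -> H) g :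
  rdot (\sum_(m <= k < n) F k) g = \sum_(m <= k < n) rdot (F k) g.
Proof.
apply: (big_morph (fun x => rdot x g)); last exact: rdot0l.
by move=> x y; rewrite rdotDl.
Qed.

Lemma sum_le_frame_sum Phi m n f :
  ((\sum_(m <= k < n) normR (inner f (Phi k)) ^+ 2)%:E <= frame_sum Phi f)%E.
Proof.
apply: (@le_trans _ _ (\sum_(0 <= k < n) normR (inner f (Phi k)) ^+ 2)%:E).
  rewrite lee_fin; have [nm|/ltnW mn] := leqP n m.
    by rewrite big_geq// sumr_ge0// => k _; rewrite sqr_ge0.
  rewrite [X in _ <= X](big_cat_nat (n := m))//= lerDr.
  by apply: sumr_ge0 => k _; rewrite sqr_ge0.
rewrite -sumEFin; apply: nneseries_lim_ge => k _ _.
by rewrite lee_fin sqr_ge0.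
Qed.

Lemma bessel_sum Phi M m n f : bessel_bound Phi M ->
  \sum_(m <= k < n) normR (inner f (Phi k)) ^+ 2 <= M * normR f ^+ 2.
Proof.
by move=> [_ PhiM]; rewrite -lee_fin (le_trans (sum_le_frame_sum _ _ _ _)).
Qed.

(* AM-GM turns the Bessel bound into
   2 |G|^2 <= M sum |c_k|^2 + |G|^2 for G = sum c_k Phi_k. *)
Lemma bessel_synthesis_sum Phi M m n c : bessel_bound Phi M ->
  normR (\sum_(m <= k < n) c k *: Phi k) ^+ 2 <=
  M * \sum_(m <= k < n) normR (c k) ^+ 2.
Proof.
move=> PhiM; have [M0 _] := PhiM; set G := \sum_(m <= k < n) _ *: _.
have GM := bessel_sum m n G PhiM.
suff : M * (normR G ^+ 2 * 2) <=
    M * (M * \sum_(m <= k < n) normR (c k) ^+ 2) +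
    \sum_(m <= k < n) normR (inner G (Phi k)) ^+ 2.
  by move=> h; rewrite -(ler_pM2l M0); lra.
rewrite -rdot_normR {1}/G rdot_suml mulr_suml !mulr_sumr -big_split/=.
apply: ler_sum => k _; have := rdotZ_le (c k) (Phi k) G.
move: (normR (c k)) (normR (inner G (Phi k))) => u v uv.
have := sqr_ge0 (M * u - v); have := ler_wpM2l (ltW M0) uv; nra.
Qed.

(** The bound E on all partial sums expresses that c lies in l^2 with |c|^2 <= E. Square-summability
    makes the partial sums of the synthesis Cauchy, and the norm bound passes to their limit. *)
Lemma bessel_synthesis_cvg Phi M c E : bessel_bound Phi M ->
  (forall n, \sum_(0 <= k < n) normR (c k) ^+ 2 <= E) ->
  series (fun n => c n *: Phi n) @ \oo -->
    synthesis_op Phi c /\ normR (synthesis_op Phi c) ^+ 2 <= M * E.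
Proof.
move=> PhiM cE; have [M0 _] := PhiM.
have c2 : cvgn (series (fun k => normR (c k) ^+ 2)).
  apply: nondecreasing_is_cvgn.
    by apply/nondecreasing_series => k _ _; rewrite sqr_ge0.
  by exists E => _ [n _ <-]; exact: cE.
have cP : cvgn (series (fun n => c n *: Phi n)).
  apply: (@cvg_dominated _ _ 2 _
    (fun n => M * series (fun k => normR (c k) ^+ 2) n)) => //.
    by apply: is_cvgM => //; exact: is_cvg_cst.
  move=> m n mn; rewrite -mulrBr !sub_series_geq//.
  exact: bessel_synthesis_sum.
split=> //.
have E0 : 0 <= E by have := cE 0; rewrite big_geq.
rewrite -(sqr_sqrtr (mulr_ge0 (ltW M0) E0)).
rewrite ler_pXn2r ?nnegrE ?sqrtr_ge0 ?normR_ge0//.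
apply: limit_normR_le cP _ => n.
rewrite -(ler_pXn2r (ltn0Sn 1)) ?nnegrE ?sqrtr_ge0 ?normR_ge0//.
rewrite sqr_sqrtr ?mulr_ge0 ?(ltW M0)//.
rewrite (le_trans (bessel_synthesis_sum 0 n c PhiM))//.
by rewrite ler_wpM2l// ltW.
Qed.

(** The operator T_Phi U_Psi; for Psi = Phi it unfolds to the frame operator. *)
Definition mixed_op Phi Psi : H -> H := synthesis_op Phi \o analysis_op Psi.

Lemma mixed_op_cvg Phi Psi M N (PhiM : bessel_bound Phi M)
    (PsiN : bessel_bound Psi N) f :
  series (fun n => inner f (Psi n) *: Phi n) @ \oo --> mixed_op Phi Psi f.
Proof. exact: (bessel_synthesis_cvg PhiM (fun n => bessel_sum 0 n f PsiN)).1. Qed.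

End Frames.
Arguments mixed_op_cvg {R H Phi Psi M N} PhiM PsiN f.

(** * Boundedness and adjoint of T_Phi U_Psi, and the frame operator *)

Section MixedOperators.
Context {R : realType} {H : hilbertType R}.
Implicit Types (Phi Psi : nat -> H) (f g : H) (M N : R).

Lemma mixed_op_normR Phi Psi M f E : bessel_bound Phi M ->
  (forall n, \sum_(0 <= k < n) normR (inner f (Psi k)) ^+ 2 <= E) ->
  normR (mixed_op Phi Psi f) ^+ 2 <= M * E.
Proof. by move=> PhiM fE; exact: (bessel_synthesis_cvg PhiM fE).2. Qed.

Lemma mixed_op_bounded Phi Psi M N :
  bessel_bound Phi M -> bessel_bound Psi N -> bounded_op (mixed_op Phi Psi).
Proof.
move=> PhiM PsiN; split=> [a f g|].
  have afg := mixed_op_cvg PhiM PsiN (a *: f + g).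
  apply: (cvg_unique (@norm_hausdorff _ _) afg) => /=.
  have : (fun n => a *: series (fun n => inner f (Psi n) *: Phi n) n +
                   series (fun n => inner g (Psi n) *: Phi n) n) @ \oo -->
      a *: mixed_op Phi Psi f + mixed_op Phi Psi g.
    apply: cvgD (mixed_op_cvg PhiM PsiN g).
    exact: cvgZl_tmp (mixed_op_cvg PhiM PsiN f).
  apply: cvg_trans; apply: near_eq_cvg; near=> n.
  rewrite !seriesEnat/= scaler_sumr -big_split/=; apply: eq_bigr => k _.
  by rewrite innerDl innerZl scalerDl scalerA.
have [M0 _] := PhiM; have [N0 _] := PsiN.
exists (Num.sqrt (M * N)) => f.
rewrite -(ler_pXn2r (ltn0Sn 1)) ?nnegrE ?mulr_ge0 ?sqrtr_ge0 ?normR_ge0//.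
rewrite exprMn sqr_sqrtr ?mulr_ge0 ?(ltW M0) ?(ltW N0)// -mulrA.
by apply: (mixed_op_normR PhiM) => n; exact: bessel_sum.
Unshelve. all: by end_near. Qed.

Lemma mixed_op_adjoint Phi Psi M N :
  bessel_bound Phi M -> bessel_bound Psi N -> forall f g,
  rdot (mixed_op Phi Psi f) g = rdot f (mixed_op Psi Phi g).
Proof.
move=> PhiM PsiN f g; have fg := cvg_rdotl (z := g) (mixed_op_cvg PhiM PsiN f).
apply: (cvg_unique (@norm_hausdorff _ R^o) fg) => /=; rewrite rdotC.
apply: cvg_trans (cvg_rdotl (z := f) (mixed_op_cvg PsiN PhiM g)).
apply: near_eq_cvg; near=> n; rewrite !seriesEnat !rdot_suml.
by apply: eq_bigr => k _; rewrite rdot_innerZ rdotC.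
Unshelve. all: by end_near. Qed.

(** Each term <f, Phi_n> <Phi_n, f> is |<f, Phi_n>|^2. The identity turns the frame inequalities
    into m |f|^2 <= <S f, f> <= M |f|^2. *)
Lemma frame_sumE Phi M f : bessel_bound Phi M ->
  frame_sum Phi f = (rdot (frame_op Phi f) f)%:E.
Proof.
move=> PhiM; have := cvg_rdotl (z := f) (mixed_op_cvg PhiM PhiM f).
have -> : (fun n => rdot (series (fun n => inner f (Phi n) *: Phi n) n) f) =
    series (fun n => normR (inner f (Phi n)) ^+ 2).
  apply/funext => n; rewrite !seriesEnat/= rdot_suml; apply: eq_bigr => k _.
  rewrite /rdot innerZl (innerC (Phi k) f) -sqr_normc.
  by rewrite normRE -rmorphXn.
move=> fl; rewrite -(cvg_lim (@Rhausdorff R) fl) -EFin_lim; last first.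
  by apply/cvg_ex; eexists; exact: fl.
congr (limn _); apply/funext => n; by rewrite /= seriesEnat/= sumEFin.
Qed.

Lemma frame_op_sqrt Phi : is_frame Phi ->
  invertible_op (frame_op Phi) /\
  exists B, [/\ bounded_op B, positive_op B & B \o B = frame_op Phi].
Proof.
move=> [m [M [m0 PhiM mPhi]]]; have [M0 MPhi] := PhiM.
have [lS _] := mixed_op_bounded PhiM PhiM.
apply: (coercive_sqrt m0 M0 lS); first exact: (mixed_op_adjoint PhiM PhiM).
by move=> f; rewrite -!lee_fin -(frame_sumE _ PhiM) mPhi MPhi.
Qed.

End MixedOperators.

(** * Identification of adjoints, inverses of roots, and the equivalence *)

Lemma adjoint_opE (R : realType) (H : hilbertType R) (A B : H -> H) :
  bounded_op B -> (forall f g, rdot (A f) g = rdot f (B g)) ->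
  adjoint_op A = B.
Proof.
move=> bB AB; have [lB _] := bB; apply: xget_unique.
  by split=> //; exact: inner_adjoint.
(* For another adjoint C and h = C g - B g, both <h, C g> and <h, B g> have real part Re <A h, g>,
   so |h|^2 = 0. *)
move=> C [_ AC]; apply/funext => g; apply/eqP; rewrite -subr_eq0 -normR_eq0.
rewrite -sqrf_eq0 -rdot_normR rdotBr -AB subr_eq0.
by rewrite /rdot AC.
Qed.

(** With C the inverse of A = B B, the inverse of B is B C. On the left, B C B = C B B (B C B) = C B
    (B B C) B = C B B = 1. *)
Lemma invertible_op_sqrt (R : realType) (H : hilbertType R) (A B : H -> H) :
  invertible_op A -> bounded_op B -> B \o B = A -> invertible_op B.
Proof.
move=> [_ [C [bC AC CA]]] bB BB.
have BBC f : B (B (C f)) = f by have := congr1 (@^~ f) AC; rewrite -BB.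
have CBB f : C (B (B f)) = f by have := congr1 (@^~ f) CA; rewrite -BB.
split=> //; exists (B \o C); split; first exact: bounded_op_comp.
  exact/funext.
by apply/funext => f /=; rewrite -[LHS]CBB BBC CBB.
Qed.

Theorem lemma2p1 (R : realType) (H : hilbertType R) (sepH : separable H)
    (Phi Psi : nat -> H) (MPhi MPsi : R)
    (framePhi : is_frame Phi) (framePsi : is_frame Psi)
    (besselPhi : bessel_bound Phi MPhi) (besselPsi : bessel_bound Psi MPsi) :
  g_dual Phi Psi <->
  exists D : H -> H,
    [/\ invertible_op D,
        synthesis_op Phi \o analysis_op Psi = sqrt_op (frame_op Phi) \o D &
        le_op (D \o adjoint_op D) (scalar_op MPsi)].
Proof.
(* Existence of a root makes the operator chosen by [sqrt_op] a positive bounded root T of S. *)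
have [iS /(xgetPex (\0 : H -> H))[]] := frame_op_sqrt framePhi.
rewrite -/(sqrt_op (frame_op Phi)).
set T := sqrt_op _ => bT posT TT.
have [lT _] := bT; have sT := positive_selfadjoint lT posT.
have iT := invertible_op_sqrt iS bT TT; have [_ [V [bV TV VT]]] := iT.
have TVE f : T (V f) = f by exact: (congr1 (@^~ f) TV).
(* <V f, g> = <V f, T V g> = <T V f, V g> = <f, V g>. *)
have sV : selfadjoint V by move=> f g; rewrite -{1}(TVE g) -sT TVE.
pose K := mixed_op Phi Psi; pose K' := mixed_op Psi Phi.
have bK : bounded_op K := mixed_op_bounded besselPhi besselPsi.
have bK' : bounded_op K' := mixed_op_bounded besselPsi besselPhi.
rewrite -/(mixed_op Phi Psi) -/K; split; last first.
  move=> [D [iD KTD _]]; have := invertible_op_comp iT iD.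
  (* K = T D is invertible, and its inverse A is the operator required by g-duality. *)
  rewrite -KTD => -[_ [A [bA KA AK]]]; exists A; split.
    by split=> //; exists K.
  move=> f; have KAf : K (A f) = f by exact: (congr1 (@^~ f) KA).
  by have := mixed_op_cvg besselPhi besselPsi (A f); rewrite -/K KAf.
move=> [A [[bA [A' [bA' AA' A'A]]] dualA]].
have KA f : K (A f) = f.
  apply: (cvg_unique (@norm_hausdorff _ _) _ (dualA f)).
  exact: (mixed_op_cvg besselPhi besselPsi (A f)).
(* K is a left inverse of the invertible A, hence also a right inverse. *)
have AK f : A (K f) = f.
  have AA'E g : A (A' g) = g by exact: (congr1 (@^~ g) AA').
  by rewrite -{1}(AA'E f) KA AA'E.
have bD : bounded_op (V \o K) := bounded_op_comp bV bK.
have bB : bounded_op (K' \o V) := bounded_op_comp bK' bV.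
have DB f g : rdot (V (K f)) g = rdot f (K' (V g)).
  by rewrite sV (mixed_op_adjoint besselPhi besselPsi).
exists (V \o K); split.
(* The inverse of D = V K is K^-1 V^-1 = A T. *)
- split=> //; exists (A \o T); split; first exact: bounded_op_comp.
    by apply/funext => f /=; rewrite KA; exact: (congr1 (@^~ f) VT).
  by apply/funext => f /=; rewrite TVE AK.
- by apply/funext => f /=; rewrite TVE.
- rewrite (adjoint_opE bB DB); apply: selfadjoint_positive => [a f g|f g|f].
  + have /= lDB := (bounded_op_comp bD bB).1 a f g.
    rewrite /scalar_op/= lDB scalerDr opprD addrACA.
    by rewrite scalerBr !scalerA mulrC.
  + rewrite /scalar_op/= rdotBl rdotBr rdotZl rdotZr DB.
    by rewrite [X in _ = _ - X]rdotC DB [X in _ = _ - X]rdotC.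
  + rewrite /scalar_op/= rdotBl rdotZl DB !rdot_normR subr_ge0.
    (* Here E = |f|^2, because the sum of |<V f, Phi_k>|^2 is <S V f, V f> = |T V f|^2 = |f|^2. *)
    apply: (mixed_op_normR besselPsi) => n; rewrite -lee_fin.
    rewrite (le_trans (sum_le_frame_sum _ _ _ _))// (frame_sumE _ besselPhi).
    by rewrite -TT /= sT TVE rdot_normR.
Qed.
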